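(* Let $\Lambda$ be a ring and let $d$ be a function assigning to every $\Lambda$-module an element of $\{0,1,2,\dots\}\cup\{\infty\}$. Let $i$ be a nonnegative integer and $0\to K\to L^{0}\to L^{1}\to\cdots\to L^{i}\to N\to0$ an exact sequence of $\Lambda$-modules. Then the following hold. (1) If $d$ satisfies $(\widetilde{d1})$ (resp. (d1)) and $d(K)-j<d(L^{j})$ for $0\le j\le i$, then $d(K)\ge d(N)+i+1$ (resp. $d(K)=d(N)+i+1$). (2) If $d$ satisfies (d2) and $d(N)+i-j<d(L^{j})$ for $0\le j\le i$, then $d(K)=d(N)+i+1$.
   Context: Conditions on a function $d$ from $\Lambda$-modules to $\{0,1,\dots\}\cup\{\infty\}$, required for every short exact sequence $0\to K\to L\to N\to0$ of $\Lambda$-modules: $(\widetilde{d1})$ if $d(L)>d(K)$, then $d(K)\ge d(N)+1$; (d1) if $d(L)>d(K)$, then $d(K)=d(N)+1$; (d2) if $d(L)>d(N)$, then $d(K)=d(N)+1$. *)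

(* Defs.v *)
From mathcomp Require Import all_boot all_order all_algebra.
From mathcomp Require Import constructive_ereal.

Set Implicit Arguments.
Unset Strict Implicit.
Unset Printing Implicit Defensive.

Import Order.TTheory GRing.Theory Num.Theory.

Local Open Scope ring_scope.
Local Open Scope ereal_scope.

(* [\bar int] is used rather than a type of extended naturals so that
   differences such as d(K) - j may be negative; a function with values in
   {0, 1, 2, ...} and +oo is a nonnegative function to [\bar int]. *)
Definition nneg_valued (R : pzRingType) (d : lmodType R -> \bar int) : Prop :=
  forall M : lmodType R, 0 <= d M.

Definition surjective (A B : Type) (f : A -> B) : Prop :=
  forall b : B, exists a : A, f a = b.

Definition exact_at (R : pzRingType) (A B C : lmodType R)
    (f : {linear A -> B}) (g : {linear B -> C}) : Prop :=
  forall b : B, g b = 0%R <-> exists a : A, f a = b.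

Definition short_exact (R : pzRingType) (K L N : lmodType R)
    (u : {linear K -> L}) (v : {linear L -> N}) : Prop :=
  [/\ injective u, exact_at u v & surjective v].

Definition cond_d1_tilde (R : pzRingType) (d : lmodType R -> \bar int) : Prop :=
  forall (K L N : lmodType R) (u : {linear K -> L}) (v : {linear L -> N}),
    short_exact u v -> d L > d K -> d K >= d N + 1.

Definition cond_d1 (R : pzRingType) (d : lmodType R -> \bar int) : Prop :=
  forall (K L N : lmodType R) (u : {linear K -> L}) (v : {linear L -> N}),
    short_exact u v -> d L > d K -> d K = d N + 1.

Definition cond_d2 (R : pzRingType) (d : lmodType R -> \bar int) : Prop :=
  forall (K L N : lmodType R) (u : {linear K -> L}) (v : {linear L -> N}),
    short_exact u v -> d L > d N -> d K = d N + 1.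

(* Image in L j of the map entering L j in K -> L 0 -> L 1 -> ... *)
Definition incoming_image (R : pzRingType) (K : lmodType R)
    (L : nat -> lmodType R) (u : {linear K -> L 0%N})
    (f : forall j : nat, {linear L j -> L j.+1}) (j : nat) : L j -> Prop :=
  match j return L j -> Prop with
  | 0 => fun x => exists k : K, u k = x
  | j'.+1 => fun x => exists y : L j', f j' y = x
  end.

(* Exactness of 0 -> K -> L 0 -> ... -> L i -> N -> 0.  Only L 0, ..., L i and
   f 0, ..., f i.-1 matter: the rest of the families [L] and [f] is
   unconstrained, and any finite sequence extends to such families by zero. *)
Definition long_exact (R : pzRingType) (i : nat) (K : lmodType R)
    (L : nat -> lmodType R) (N : lmodType R) (u : {linear K -> L 0%N})
    (f : forall j : nat, {linear L j -> L j.+1}) (v : {linear L i -> N})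
    : Prop :=
  [/\ injective u,
      forall j : nat, (j < i)%N ->
        forall x : L j, f j x = 0%R <-> incoming_image u f x,
      forall x : L i, v x = 0%R <-> incoming_image u f x
    & surjective v].

(* Main.v *)
(** Cutting the sequence at the image C of L 0 -> L 1 gives 0 -> K -> L 0 -> C -> 0
    and 0 -> C -> L 1 -> ... -> L i -> N -> 0.  For d1 and its weak form, the
    short sequence first bounds d C by d K - 1, so induction applies to C; for
    d2, induction first gives d C = d N + i, which d (L 0) exceeds. *)

Require Import Defs.
From HB Require Import structures.
From mathcomp Require Import all_boot all_order all_algebra.
From mathcomp Require Import constructive_ereal boolp zify.

Import Order.TTheory GRing.Theory Num.Theory.

Local Open Scope ring_scope.
Local Open Scope ereal_scope.

Section LinearImage.
Variables (R : pzRingType) (A B : lmodType R) (f : {linear A -> B}).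

Definition lin_img : {pred B} := fun b => `[< exists a : A, f a = b >].

Lemma lin_img_submod_closed : submod_closed lin_img.
Proof.
split; first by apply/asboolP; exists 0%R; rewrite linear0.
move=> c x y /asboolP[a <-] /asboolP[b <-].
by apply/asboolP; exists (c *: a + b)%R; rewrite linearP.
Qed.

HB.instance Definition _ :=
  GRing.isSubmodClosed.Build R B lin_img lin_img_submod_closed.

Record lin_image := LinImage {
  lin_image_val : B;
  lin_imageP : lin_image_val \in lin_img }.

HB.instance Definition _ := [isSub for lin_image_val].
HB.instance Definition _ := [Choice of lin_image by <:].
HB.instance Definition _ := [SubChoice_isSubLmodule of lin_image by <:].

Lemma lin_img_mem (a : A) : f a \in lin_img.
Proof. by apply/asboolP; exists a. Qed.

Definition lin_corestr (a : A) : lin_image := LinImage _ (lin_img_mem a).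

Lemma lin_corestr_is_linear : linear lin_corestr.
Proof. by move=> c x y; apply: val_inj; rewrite [RHS]linearP; exact: linearP. Qed.

HB.instance Definition _ :=
  GRing.isLinear.Build R A lin_image _ lin_corestr lin_corestr_is_linear.

End LinearImage.

Section Dimension.
Variables (R : pzRingType) (d : lmodType R -> \bar int).
Implicit Types K N : lmodType R.

Lemma long_exact0 K (L : nat -> lmodType R) N (u : {linear K -> L 0%N})
    (f : forall j : nat, {linear L j -> L j.+1}) (v : {linear L 0%N -> N}) :
  long_exact u f v -> short_exact u v.
Proof. by case=> u_inj _ exact_v v_surj; split. Qed.

Lemma long_exact_split i K (L : nat -> lmodType R) N (u : {linear K -> L 0%N})
    (f : forall j : nat, {linear L j -> L j.+1}) (v : {linear L i.+1 -> N}) :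
  long_exact u f v ->
  exists (C : lmodType R) (p : {linear L 0%N -> C}) (w : {linear C -> L 1%N}),
    short_exact u p /\
    @long_exact R i C (fun j => L j.+1) N w (fun j => f j.+1) v.
Proof.
case=> u_inj exact_f exact_v v_surj.
pose C : lmodType R := lin_image _ _ _ (f 0%N).
pose p : {linear L 0%N -> C} := lin_corestr _ _ _ (f 0%N).
pose w : {linear C -> L 1%N} := (val : C -> L 1%N).
have incoming_w j (x : L j.+1) :
    incoming_image u f x <->
    @incoming_image R C (fun j => L j.+1) w (fun j => f j.+1) j x.
  case: j x => [|j] x //=; split=> [[y <-]|[c <-]]; first by exists (p y).
  by case: c => b /= /asboolP.
exists C, p, w; split; split => //.
- move=> x; rewrite -[(exists _, _)]/(incoming_image u f x) -exact_f //.
  by split=> [/(congr1 val)|fx0] //; apply: val_inj.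
- by case=> b b_im; case/asboolP: (b_im) => a fa; exists a; apply: val_inj.
- exact: val_inj.
- by move=> j lt_ji x; rewrite exact_f //; apply: incoming_w.
- by move=> x; rewrite exact_v; apply: incoming_w.
Qed.

Lemma d1_tilde_long_exact i K (L : nat -> lmodType R) N
    (u : {linear K -> L 0%N}) (f : forall j : nat, {linear L j -> L j.+1})
    (v : {linear L i -> N}) :
  cond_d1_tilde d -> long_exact u f v ->
  (forall j : nat, (j <= i)%N -> d K - j%:Z%:E < d (L j)) ->
  d K >= d N + i%:Z%:E + 1.
Proof.
move=> d1; elim: i K L u f v => [|i IH] K L u f v.
  move=> /long_exact0 exact_uv /(_ 0%N isT); rewrite sube0 adde0.
  exact: d1 exact_uv.
move=> /long_exact_split[C [p [w [exact_up exact_wv]]]] dL.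
have := dL 0%N isT; rewrite sube0 => /(d1 _ _ _ _ _ exact_up) dCK.
suff: d N + i%:Z%:E + 1 <= d C.
  by case: (d N) (d C) (d K) dCK => [n||] [c||] [k||] //=; rewrite ?(lee_fin, leey, leNye) //; lia.
apply: IH exact_wv _ => j le_ji; apply: le_lt_trans (dL j.+1 le_ji).
by case: (d C) (d K) dCK => [c||] [k||] //=; rewrite ?(lee_fin, leey, leNye) //; lia.
Qed.

Lemma d1_long_exact i K (L : nat -> lmodType R) N
    (u : {linear K -> L 0%N}) (f : forall j : nat, {linear L j -> L j.+1})
    (v : {linear L i -> N}) :
  cond_d1 d -> long_exact u f v ->
  (forall j : nat, (j <= i)%N -> d K - j%:Z%:E < d (L j)) ->
  d K = d N + i%:Z%:E + 1.
Proof.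
move=> d1; elim: i K L u f v => [|i IH] K L u f v.
  move=> /long_exact0 exact_uv /(_ 0%N isT); rewrite sube0 adde0.
  exact: d1 exact_uv.
move=> /long_exact_split[C [p [w [exact_up exact_wv]]]] dL.
have := dL 0%N isT; rewrite sube0 => /(d1 _ _ _ _ _ exact_up) dKC.
rewrite dKC (IH _ _ _ _ _ exact_wv); last first.
  move=> j le_ji; apply: le_lt_trans (dL j.+1 le_ji); rewrite dKC.
  by case: (d C) => [c||] //=; rewrite lee_fin; lia.
by case: (d N) => [n||] //=; congr (_%:E); lia.
Qed.

Lemma d2_long_exact i K (L : nat -> lmodType R) N
    (u : {linear K -> L 0%N}) (f : forall j : nat, {linear L j -> L j.+1})
    (v : {linear L i -> N}) :
  cond_d2 d -> long_exact u f v ->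
  (forall j : nat, (j <= i)%N -> d N + i%:Z%:E - j%:Z%:E < d (L j)) ->
  d K = d N + i%:Z%:E + 1.
Proof.
move=> d2; elim: i K L u f v => [|i IH] K L u f v.
  move=> /long_exact0 exact_uv /(_ 0%N isT); rewrite sube0 adde0.
  exact: d2 exact_uv.
move=> /long_exact_split[C [p [w [exact_up exact_wv]]]] dL.
have dC : d C = d N + i.+1%:Z%:E.
  rewrite (IH _ _ _ _ _ exact_wv) => [|j le_ji].
    by case: (d N) => [n||] //=; congr (_%:E); lia.
  apply: le_lt_trans (dL j.+1 le_ji).
  by case: (d N) => [n||] //=; rewrite lee_fin; lia.
have := dL 0%N isT; rewrite sube0 -dC.
exact: d2 exact_up.
Qed.

End Dimension.

Theorem proposition2p1 (R : pzRingType) (d : lmodType R -> \bar int)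
    (d_nneg : nneg_valued d) (i : nat)
    (K : lmodType R) (L : nat -> lmodType R) (N : lmodType R)
    (u : {linear K -> L 0%N}) (f : forall j : nat, {linear L j -> L j.+1})
    (v : {linear L i -> N}) (exactKLN : long_exact u f v) :
  [/\ cond_d1_tilde d ->
        (forall j : nat, (j <= i)%N -> d K - j%:Z%:E < d (L j)) ->
        d K >= d N + i%:Z%:E + 1,
      cond_d1 d ->
        (forall j : nat, (j <= i)%N -> d K - j%:Z%:E < d (L j)) ->
        d K = d N + i%:Z%:E + 1
    & cond_d2 d ->
        (forall j : nat, (j <= i)%N ->
           d N + i%:Z%:E - j%:Z%:E < d (L j)) ->
        d K = d N + i%:Z%:E + 1].
Proof.
split=> cond_d.
- exact: d1_tilde_long_exact cond_d exactKLN.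
- exact: d1_long_exact cond_d exactKLN.
- exact: d2_long_exact cond_d exactKLN.
Qed.
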